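(* Let $G=\mathbb{Z}^N$ for some $N\in\mathbb{N}$, and let $L(\cdot)$ be one of $|\cdot|_1$, $|\cdot|_2$ or $|\cdot|_2^2$ (the usual $\ell^1$-norm, $\ell^2$-norm, or squared $\ell^2$-norm on $\mathbb{Z}^N$). For $r\in(0,1)$ set $\varphi_r=r^{L}$. Then for every normalized 2-cocycle $\sigma$ on $\mathbb{Z}^N$, $\{\varphi_r\}_{r\to1^-}$ is a bounded Fourier summing net for $(G,\sigma)$; in particular $\sum_{g\in\mathbb{Z}^N}r^{L(g)}\widehat x(g)\Lambda_\sigma(g)\to x$ in operator norm as $r\to1^-$, for every $x\in C^*_r(\mathbb{Z}^N,\sigma)$.
   Context: $\sigma:G\times G\to\mathbb{T}$ is a normalized 2-cocycle ($\sigma(g,h)\sigma(gh,k)=\sigma(h,k)\sigma(g,hk)$, $\sigma(g,e)=\sigma(e,g)=1$); $\Lambda_\sigma(g)$ is the unitary on $\ell^2(G)$ with $(\Lambda_\sigma(g)\xi)(h)=\sigma(g,g^{-1}h)\xi(g^{-1}h)$; $C^*_r(G,\sigma)$ is the operator-norm closure of $\mathrm{span}\,\Lambda_\sigma(G)$; for $x\in C^*_r(G,\sigma)$, $\widehat x=x\delta_e$. For $\varphi:G\to\mathbb{C}$, $M_\varphi$ is the linear map with $M_\varphi(\Lambda_\sigma(g))=\varphi(g)\Lambda_\sigma(g)$ (extended to $C^*_r(G,\sigma)$ when bounded). $MCF(G,\sigma)$ is the set of $\varphi$ such that $\sum_g\varphi(g)\widehat x(g)\Lambda_\sigma(g)$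 converges in operator norm (as a net of finite partial sums) for all $x\in C^*_r(G,\sigma)$. A net $\{\varphi_\alpha\}$ is a Fourier summing net for $(G,\sigma)$ if each $\varphi_\alpha\in MCF(G,\sigma)$ and $M_{\varphi_\alpha}(x)\to x$ in operator norm for every $x$; it is bounded if $\sup_\alpha\|M_{\varphi_\alpha}\|<\infty$. *)

(* Defs.v *)
From HB Require Import structures.
From mathcomp Require Import all_boot all_order all_algebra.
From mathcomp Require Import all_classical all_reals all_analysis.
From mathcomp Require Import complex.
Set Implicit Arguments. Unset Strict Implicit. Unset Printing Implicit Defensive.
Import Order.TTheory GRing.Theory Num.Theory.
Local Open Scope ring_scope.

Section Defs.
Variables (R : realType) (N : nat).
Local Notation C := (R[i]).
Local Notation G := ('rV[int]_N).

Definition cabs2 (z : C) : R := (@complex.Re R z) ^+ 2 + (@complex.Im R z) ^+ 2.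

Definition is_normalized_2cocycle (sigma : G -> G -> C) : Prop :=
  [/\ (forall g h, cabs2 (sigma g h) = 1),
      (forall g h k, sigma g h * sigma (g + h) k = sigma h k * sigma g (h + k))
    & (forall g, sigma g 0 = 1 /\ sigma 0 g = 1)].

Definition l2sq (xi : G -> C) : \bar R :=
  (\esum_(g in [set: G]) ((cabs2 (xi g))%:E))%E.

(* operators on C^G (only their action on l^2(G) matters) *)
Definition op := (G -> C) -> (G -> C).

Definition opnorm (T : op) : \bar R :=
  ereal_sup [set sqrte (l2sq (T xi)) | xi in [set xi | (l2sq xi <= 1)%E]].

Definition opsub (A B : op) : op := fun xi h => A xi h - B xi h.

Definition opnorm_lt (T : op) (eps : R) : Prop := (opnorm T < eps%:E)%E.

Definition Lam (sigma : G -> G -> C) (g : G) : op :=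
  fun xi h => sigma g (h - g) * xi (h - g).

Definition lincomb (sigma : G -> G -> C) (F : seq G) (c : G -> C) : op :=
  fun xi h => \sum_(g <- F) c g * Lam sigma g xi h.

Definition in_Cred (sigma : G -> G -> C) (x : op) : Prop :=
  forall eps : R, 0 < eps ->
    exists (F : seq G) (c : G -> C), opnorm_lt (opsub x (lincomb sigma F c)) eps.

Definition delta_e : G -> C := fun h => if h == 0 then 1 else 0.

Definition xhat (x : op) : G -> C := x delta_e.

Definition fourier_series_to (sigma : G -> G -> C) (phi : G -> C) (x S : op) : Prop :=
  forall eps : R, 0 < eps -> exists F0 : seq G, forall F : seq G,
    uniq F -> {subset F0 <= F} ->
    opnorm_lt (opsub S (lincomb sigma F (fun g => phi g * xhat x g))) eps.

Definition in_MCF (sigma : G -> G -> C) (phi : G -> C) : Prop :=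
  forall x, in_Cred sigma x -> exists S, fourier_series_to sigma phi x S.

Definition l1norm (g : G) : R := \sum_(i < N) `|(g ord0 i)%:~R : R|.
Definition l2norm2 (g : G) : R := \sum_(i < N) ((g ord0 i)%:~R : R) ^+ 2.
Definition l2norm (g : G) : R := Num.sqrt (l2norm2 g).

(* M_phi is bounded on span Lambda_sigma(G) with ||M_phi|| <= M
   (equivalently, its continuous extension to C*_r(G,sigma) has norm <= M) *)
Definition mult_bounded_by (sigma : G -> G -> C) (phi : G -> C) (M : R) : Prop :=
  forall (F : seq G) (c : G -> C),
    let A := lincomb sigma F (fun g => phi g * c g) in
    let B := lincomb sigma F c in
    (opnorm A <= M%:E * opnorm B)%E.

Definition summing_left1 (sigma : G -> G -> C) (phi : R -> G -> C) (x : op) : Prop :=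
  forall eps : R, 0 < eps ->
    exists2 r0 : R, r0 < 1 &
      forall r : R, r0 < r -> r < 1 -> forall S : op,
        fourier_series_to sigma (phi r) x S -> opnorm_lt (opsub S x) eps.

Definition bounded_fourier_summing_net_left1 (sigma : G -> G -> C)
    (phi : R -> G -> C) : Prop :=
  [/\ (forall r : R, 0 < r -> r < 1 -> in_MCF sigma (phi r)),
      (exists M : R, forall r : R, 0 < r -> r < 1 -> mult_bounded_by sigma (phi r) M)
    & (forall x : op, in_Cred sigma x -> summing_left1 sigma phi x)].

End Defs.

(* Main.v *)
(** Conjugating by the unitary of multiplication by a character chi of Z^N turns
    Lambda_sigma(g) into chi(g) Lambda_sigma(g), so characters are isometric
    multipliers whatever the cocycle is.  Multipliers of norm at most 1 are stable
    under products, convex combinations and pointwise limits.  Hence cos(theta g_i)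
    is one; so is exp(-c(1-f)) for every real one f and c >= 0, by expanding the
    exponential; letting theta tend to 0 in exp(-2t(1-cos(theta g_i))/theta^2)
    yields exp(-t g_i^2), and the product over i yields exp(-t|g|_2^2).
    If all exp(-s psi) are contractive multipliers, then 1 - sqrt(1 - exp(-s psi))
    is one, because the iteration w := (u + w^2)/2 converges to 1 - sqrt(1-u);
    exponentiating and rescaling as s -> 0 gives exp(-t sqrt psi).  Taking for psi
    |g|_2^2 or g_i^2 (with sqrt (g_i^2) = |g_i|) covers the two remaining lengths.

    As r^L is summable, the Fourier series of M_phi(x) converges absolutely, and
    approximating x by trigonometric polynomials reduces the convergence
    M_phi(x) -> x to the pointwise convergence r^L -> 1. *)

Require Import Defs.
From mathcomp Require Import all_boot all_order all_algebra.
From mathcomp Require Import all_classical all_reals all_analysis.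
From mathcomp Require Import complex zify ring lra.
Set Implicit Arguments.
Unset Strict Implicit.
Unset Printing Implicit Defensive.
Import Order.TTheory GRing.Theory Num.Theory.
Import numFieldNormedType.Exports.
Local Open Scope classical_set_scope.
Local Open Scope ring_scope.
Local Open Scope complex_scope.

(** * Operator bounds tested on finite sums, and Minkowski's inequality *)

Section Operators.
Variable R : realType.
Local Notation C := (R[i]).
Local Notation normc := (@ComplexField.Normc.normc R).

Lemma cabs2_ge0 (z : C) : 0 <= cabs2 z.
Proof. by rewrite addr_ge0 ?sqr_ge0. Qed.

Lemma cabs2M (z w : C) : cabs2 (z * w) = cabs2 z * cabs2 w.
Proof. by case: z w => [a b] [c d]; rewrite /cabs2 /=; ring. Qed.

Lemma cabs2_0 : cabs2 (0 : C) = 0.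
Proof. by rewrite /cabs2 /= expr0n addr0. Qed.

Lemma cabs2_eq0 (z : C) : cabs2 z = 0 -> z = 0.
Proof.
case: z => a b /eqP; rewrite /cabs2 paddr_eq0 ?sqr_ge0 //= !sqrf_eq0.
by case/andP => /eqP -> /eqP ->.
Qed.

Lemma normc_sqr (z : C) : normc z ^+ 2 = cabs2 z.
Proof. by case: z => a b; rewrite /= sqr_sqrtr // addr_ge0 ?sqr_ge0. Qed.

Lemma normc_ge0 (z : C) : 0 <= normc z.
Proof. by case: z => a b; rewrite sqrtr_ge0. Qed.

Lemma normcR (a : R) : 0 <= a -> normc a%:C = a.
Proof. by move=> a0; rewrite /= expr0n addr0 sqrtr_sqr ger0_norm. Qed.

Lemma normc_le (z : C) (M : R) : 0 <= M -> cabs2 z <= M ^+ 2 -> normc z <= M.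
Proof.
by move=> M0; rewrite -normc_sqr ler_pXn2r ?nnegrE ?normc_ge0.
Qed.

(** The right side minus the left side is |B z - A w|^2. *)
Lemma convex_cabs2 (A B : R) (z w : C) : 0 <= A -> 0 <= B ->
  A * B * cabs2 (z + w) <= (A + B) * (B * cabs2 z + A * cabs2 w).
Proof.
move=> A0 B0; case: z w => [a b] [c d]; rewrite /cabs2 /= -subr_ge0.
rewrite (_ : _ - _ = (B * a - A * c) ^+ 2 + (B * b - A * d) ^+ 2); last ring.
by rewrite addr_ge0 ?sqr_ge0.
Qed.

(** For A, B > 0, [convex_cabs2] summed over H gives the bound without Cauchy-Schwarz: the right
    side becomes (A + B)(B A^2 + A B^2) = A B (A + B)^2, and A B cancels. *)
Lemma minkowski_cabs2 (T : eqType) (H : seq T) (f g : T -> C) (A B : R) :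
  0 <= A -> 0 <= B ->
  \sum_(h <- H) cabs2 (f h) <= A ^+ 2 -> \sum_(h <- H) cabs2 (g h) <= B ^+ 2 ->
  \sum_(h <- H) cabs2 (f h + g h) <= (A + B) ^+ 2.
Proof.
(* If A or B is 0, the factor A B cannot be cancelled; the corresponding function then vanishes on
   H. *)
have zero (k : T -> C) : \sum_(h <- H) cabs2 (k h) <= 0 -> {in H, forall h, k h = 0}.
  move=> k0; have : \sum_(h <- H) cabs2 (k h) == 0.
    by rewrite eq_le k0 sumr_ge0 // => h _; exact: cabs2_ge0.
  rewrite psumr_eq0 => [/allP a|h _]; last exact: cabs2_ge0.
  by move=> h /a /= /eqP /cabs2_eq0.
rewrite le0r => /orP[/eqP ->|A0].
  move=> _; rewrite expr0n add0r => /zero f0.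
  by under [X in _ -> X <= _]eq_big_seq => h /f0 -> do rewrite add0r.
rewrite le0r => /orP[/eqP ->|B0].
  rewrite expr0n addr0 => + /zero g0.
  by under [X in _ -> X <= _]eq_big_seq => h /g0 -> do rewrite addr0.
move=> fA gB; rewrite -(ler_pM2l (mulr_gt0 A0 B0)).
apply: (@le_trans _ _ ((A + B) * (B * A ^+ 2 + A * B ^+ 2))); last first.
  by rewrite le_eqVlt; apply/orP; left; apply/eqP; ring.
apply: (@le_trans _ _ ((A + B) * (B * (\sum_(h <- H) cabs2 (f h)) +
    A * (\sum_(h <- H) cabs2 (g h))))); last first.
  by rewrite ler_pM2l ?addr_gt0// lerD// ler_pM2l.
rewrite !mulr_sumr -big_split mulr_sumr/=; apply: ler_sum => h _.
by apply: convex_cabs2; exact: ltW.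
Qed.

Variable N : nat.
Local Notation G := ('rV[int]_N).
Implicit Types (T A B : op R N) (xi : G -> C) (F H : seq G).

(** The unit ball of l^2(G) and, below, the bound ||T|| <= M are phrased with finite partial sums,
    so that later estimates stay in R; [l2sq_le] and [opnorm_le] link them to the extended-real
    sums. *)
Definition unit_ball xi : Prop :=
  forall H, uniq H -> \sum_(h <- H) cabs2 (xi h) <= 1.

Definition opbd T (M : R) : Prop :=
  forall xi, unit_ball xi ->
  forall H, uniq H -> \sum_(h <- H) cabs2 (T xi h) <= M ^+ 2.

Lemma l2sq_le xi (M : R) :
  (l2sq xi <= M%:E)%E <->
  (forall H, uniq H -> \sum_(h <- H) cabs2 (xi h) <= M).
Proof.
split=> [le H uH|le].
  rewrite -lee_fin; apply: le_trans le; apply: esum_ge.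
  exists [set` H]; first by split => //; exact: finite_seq.
  by rewrite -fsbig_seq// sumEFin.
apply: ge_ereal_sup => _ /= [X [/finite_fsetP[Y ->] _] <-].
by rewrite -fsbig_seq ?finmap.fset_uniq // sumEFin lee_fin le // finmap.fset_uniq.
Qed.

Lemma l2sq_ge0 xi : (0 <= l2sq xi)%E.
Proof. by apply: esum_ge0 => h _; rewrite lee_fin cabs2_ge0. Qed.

(** The sign condition is needed because [opbd] sees only M^2. *)
Lemma opnorm_le T (M : R) : 0 <= M -> (opnorm T <= M%:E)%E <-> opbd T M.
Proof.
move=> M0; split=> [le xi /l2sq_le xi1|bd].
  apply/l2sq_le.
  have /le_trans /(_ le) : (sqrte (l2sq (T xi)) <= opnorm T)%E.
    by apply: ereal_sup_ubound; exists xi.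
  move: (l2sq_ge0 (T xi)); case: (l2sq (T xi)) => [a||] //=.
  rewrite !lee_fin => a0 aM; rewrite -(sqr_sqrtr a0).
  by rewrite ler_pXn2r ?nnegrE ?sqrtr_ge0.
apply: ge_ereal_sup => _ /= [xi /l2sq_le xi1 <-].
have /l2sq_le := bd _ xi1.
move: (l2sq_ge0 (T xi)); case: (l2sq (T xi)) => [a||] //=.
rewrite !lee_fin => a0 aM.
by rewrite -(ler_pXn2r (n:=2)) ?nnegrE ?sqrtr_ge0// sqr_sqrtr.
Qed.

Lemma opnorm_ge0 T : (0 <= opnorm T)%E.
Proof.
apply: (@le_trans _ _ (sqrte (l2sq (T (fun=> 0))))).
  by move: (l2sq_ge0 (T (fun=> 0))); case: l2sq => //= a _; rewrite lee_fin sqrtr_ge0.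
apply: ereal_sup_ubound; exists (fun=> 0) => //=.
by apply/l2sq_le => H _; rewrite big1// => h _; rewrite cabs2_0.
Qed.

Lemma opnorm_lt_opbd T (e : R) : opnorm_lt T e -> 0 < e /\ opbd T e.
Proof.
move=> le; have e0 : 0 < e by rewrite -lte_fin; exact: le_lt_trans (opnorm_ge0 T) le.
by split=> //; apply/opnorm_le; exact: ltW.
Qed.

Lemma opbd_opnorm_lt T (M e : R) : 0 <= M -> M < e -> opbd T M -> opnorm_lt T e.
Proof. by move=> M0 Me /opnorm_le -/(_ M0) le; apply: le_lt_trans le _; rewrite lte_fin. Qed.

Lemma opbd_le T (M M' : R) : 0 <= M -> M <= M' -> opbd T M -> opbd T M'.
Proof.
move=> M0 MM' TM xi xi1 H uH; apply: le_trans (TM _ xi1 _ uH) _.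
by rewrite ler_pXn2r ?nnegrE// (le_trans M0).
Qed.

Lemma opbd_pt T (M : R) xi h : 0 <= M -> opbd T M -> unit_ball xi -> normc (T xi h) <= M.
Proof.
move=> M0 TM xi1; apply: normc_le => //.
by have := TM _ xi1 [:: h] isT; rewrite big_seq1.
Qed.

Lemma opbdD S T (A B : R) : 0 <= A -> 0 <= B ->
  opbd S A -> opbd T B -> opbd (fun xi h => S xi h + T xi h) (A + B).
Proof.
by move=> A0 B0 SA TB xi xi1 H uH; apply: minkowski_cabs2; [..|exact: SA|exact: TB].
Qed.

Lemma opbdZ T (M : R) (a : C) : opbd T M -> opbd (fun xi h => a * T xi h) (normc a * M).
Proof.
move=> TM xi xi1 H uH; under eq_bigr do rewrite cabs2M.
by rewrite -mulr_sumr exprMn normc_sqr ler_wpM2l ?cabs2_ge0// TM.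
Qed.

Lemma opbd_sub S T (A B : R) : 0 <= A -> 0 <= B ->
  opbd S A -> opbd T B -> opbd (opsub S T) (A + B).
Proof.
move=> A0 B0 SA /(opbdZ (-1)) TB; rewrite /opsub.
have := opbdD A0 _ SA TB.
have -> : normc (-1) = 1.
  by rewrite /= oppr0 expr0n addr0 sqrrN expr1n sqrtr1.
rewrite mul1r => /(_ B0); congr (opbd _ _).
by apply/funext => xi; apply/funext => h; rewrite mulN1r.
Qed.

Lemma opbd0 : opbd (fun _ _ => 0) 0.
Proof. by move=> xi _ H _; rewrite big1 ?expr0n// => h _; rewrite cabs2_0. Qed.

End Operators.

(** * Fourier multipliers with a norm bound, and their stability properties *)

Section Multipliers.
Variables (R : realType) (N : nat).
Local Notation C := (R[i]).
Local Notation G := ('rV[int]_N).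
Local Notation normc := (@ComplexField.Normc.normc R).
Variable sigma : G -> G -> C.
Hypothesis sigma1 : forall g h, cabs2 (sigma g h) = 1.
Implicit Types (xi : G -> C) (F H : seq G) (c : G -> C) (phi psi : G -> C).

Lemma lincomb_cons g F c xi h :
  lincomb sigma (g :: F) c xi h = c g * Lam sigma g xi h + lincomb sigma F c xi h.
Proof. by rewrite /lincomb big_cons. Qed.

Lemma unit_ball_shift xi g : unit_ball xi -> unit_ball (fun h => xi (h - g)).
Proof.
move=> xi1 H uH; rewrite -(big_map (fun h => h - g) xpredT (fun h => cabs2 (xi h))).
by apply: xi1; rewrite map_inj_uniq//; exact: addIr.
Qed.

Lemma opbd_Lam g : opbd (Lam sigma g) 1.
Proof.
move=> xi xi1 H uH; under eq_bigr do rewrite cabs2M sigma1 mul1r.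
by rewrite expr1n; exact: unit_ball_shift.
Qed.

Lemma opbd_lincomb F c : opbd (lincomb sigma F c) (\sum_(g <- F) normc (c g)).
Proof.
elim: F => [|g F IH].
  rewrite big_nil; have := @opbd0 R N; congr (opbd _ _).
  by apply/funext => xi; apply/funext => h; rewrite /lincomb big_nil.
have := opbdD _ _ (opbdZ (c g) (opbd_Lam g)) IH.
rewrite mulr1 big_cons => bd.
have -> : lincomb sigma (g :: F) c =
    fun xi h => c g * Lam sigma g xi h + lincomb sigma F c xi h.
  by apply/funext => xi; apply/funext => h; rewrite lincomb_cons.
apply: bd; first exact: normc_ge0.
by rewrite sumr_ge0// => k _; exact: normc_ge0.
Qed.

(** The bound ||M_phi|| <= m on trigonometric polynomials. Quantifying over every upper bound M,
    rather than using the norm itself, lets multipliers be composed by chaining. *)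
Definition multiplier phi (m : R) := forall F c (M : R), 0 <= M ->
  opbd (lincomb sigma F c) M ->
  opbd (lincomb sigma F (fun g => phi g * c g)) (m * M).

Lemma multiplierD phi psi (m m' : R) : 0 <= m -> 0 <= m' ->
  multiplier phi m -> multiplier psi m' ->
  multiplier (fun g => phi g + psi g) (m + m').
Proof.
move=> m0 m0' phim psim F c M M0 FM.
have := opbdD _ _ (phim _ _ _ M0 FM) (psim _ _ _ M0 FM).
rewrite -mulrDl => /(_ (mulr_ge0 m0 M0) (mulr_ge0 m0' M0)); congr (opbd _ _).
apply/funext => xi; apply/funext => h; rewrite /lincomb -big_split/=.
by apply: eq_bigr => g _; rewrite -!mulrDl.
Qed.

Lemma multiplierM phi psi (m m' : R) : 0 <= m' ->
  multiplier phi m -> multiplier psi m' ->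
  multiplier (fun g => phi g * psi g) (m * m').
Proof.
move=> m0' phim psim F c M M0 FM.
have := phim _ _ _ (mulr_ge0 m0' M0) (psim _ _ _ M0 FM); rewrite mulrA.
by congr (opbd (lincomb _ _ _) _); apply/funext => g; rewrite mulrA.
Qed.

Lemma multiplier_char (chi : G -> C) :
  (forall g h, chi (g + h) = chi g * chi h) -> (forall g, cabs2 (chi g) = 1) ->
  multiplier chi 1.
Proof.
move=> chiD chi1 F c M M0 FM xi xi1 H uH; rewrite mul1r.
have chiJ g : chi g * conjc (chi g) = 1.
  have := chi1 g; case: (chi g) => a b; rewrite /cabs2 /= => ab.
  by apply/eqP; rewrite eq_complex /= -ab; apply/andP; split; apply/eqP; ring.
have chiJ1 g : cabs2 (conjc (chi g)) = 1.
  by rewrite -(chi1 g); case: (chi g) => a b; rewrite /cabs2 /= sqrrN.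
pose xi' h := conjc (chi h) * xi h.
have xi'1 : unit_ball xi'.
  move=> K uK; under eq_bigr do rewrite cabs2M chiJ1 mul1r.
  exact: xi1.
apply: le_trans (FM _ xi'1 _ uH); apply: ler_sum => h _.
(* The conjugation identity: chi h = chi (h - g) * chi g, and the factor chi (h - g) is cancelled by
   its conjugate inside [xi']. *)
have -> : lincomb sigma F (fun g => chi g * c g) xi h =
    chi h * lincomb sigma F c xi' h.
  rewrite /lincomb mulr_sumr; apply: eq_bigr => g _; rewrite /Lam /xi'.
  have -> : chi h = chi (h - g) * chi g by rewrite -chiD subrK.
  rewrite -[chi g * c g * _]mulr1 -(chiJ (h - g)); ring.
by rewrite cabs2M chi1 mul1r.
Qed.

Lemma multiplier_const (a : R) : 0 <= a -> multiplier (fun=> a%:C) a.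
Proof.
move=> a0 F c M M0 FM; have := opbdZ a%:C FM; rewrite normcR//.
congr (opbd _ _); apply/funext => xi; apply/funext => h.
by rewrite /lincomb mulr_sumr; apply: eq_bigr => g _; rewrite mulrA.
Qed.

Lemma multiplier_eq phi psi (m : R) : phi =1 psi -> multiplier phi m -> multiplier psi m.
Proof. by move=> /funext ->. Qed.

Definition rmultiplier (f : G -> R) (m : R) := multiplier (fun g => (f g)%:C) m.

Lemma rmultiplierD f1 f2 m1 m2 : 0 <= m1 -> 0 <= m2 ->
  rmultiplier f1 m1 -> rmultiplier f2 m2 ->
  rmultiplier (fun g => f1 g + f2 g) (m1 + m2).
Proof.
move=> m10 m20 h1 h2; apply: multiplier_eq (multiplierD m10 m20 h1 h2) => g /=.
by rewrite rmorphD.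
Qed.

Lemma rmultiplierM f1 f2 m1 m2 : 0 <= m2 ->
  rmultiplier f1 m1 -> rmultiplier f2 m2 ->
  rmultiplier (fun g => f1 g * f2 g) (m1 * m2).
Proof.
move=> m20 h1 h2; apply: multiplier_eq (multiplierM m20 h1 h2) => g /=.
by rewrite rmorphM.
Qed.

Lemma rmultiplierZ a f m : 0 <= a -> 0 <= m -> rmultiplier f m ->
  rmultiplier (fun g => a * f g) (a * m).
Proof. by move=> a0 m0; apply: rmultiplierM m0 (multiplier_const a0). Qed.

Lemma rmultiplier_le f m m' : 0 <= m -> m <= m' -> rmultiplier f m -> rmultiplier f m'.
Proof.
move=> m0 mm' fm F c M M0 FM; apply: opbd_le (fm _ _ _ M0 FM); first exact: mulr_ge0.
exact: ler_wpM2r.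
Qed.

Lemma cvg_sum_seq (T : Type) (FF : set_system T) (FFF : Filter FF) (I : Type)
    (r : seq I) (f : I -> T -> R) (l : I -> R) :
  (forall i, f i t @[t --> FF] --> l i) ->
  \sum_(i <- r) f i t @[t --> FF] --> \sum_(i <- r) l i.
Proof.
move=> fl; elim: r => [|i r IH].
  by rewrite big_nil; under eq_cvg do rewrite big_nil; exact: cvg_cst.
by rewrite big_cons; under eq_cvg do rewrite big_cons; exact: cvgD.
Qed.

(** For fixed F, c, xi and H the bounded quantity depends continuously on finitely many values of
    the symbol. A general filter covers both sequences and limits as h tends to 0 from the right. *)
Lemma rmultiplier_lim (T : Type) (FF : set_system T) (FFF : ProperFilter FF)
    (f : T -> G -> R) (l : G -> R) (m : R) :
  (forall g, f t g @[t --> FF] --> l g) ->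
  (\forall t \near FF, rmultiplier (f t) m) -> rmultiplier l m.
Proof.
move=> fl fm F c M M0 FM xi xi1 H uH.
pose s (q : G -> R) := \sum_(h <- H)
  cabs2 (lincomb sigma F (fun g => (q g)%:C * c g) xi h).
suff sl : s (f t) @[t --> FF] --> s l.
  apply: (cvgr_to_le sl).
  by apply: filterS fm => t /(_ F c M M0 FM xi xi1 H uH).
apply: cvg_sum_seq => h; rewrite /cabs2.
(* Here p stands for the real or the imaginary part: being real-linear, it turns the polynomial into
   a finite real combination of the values of the symbol. *)
have proj (p : C -> R) : (forall z w, p (z + w) = p z + p w) -> p 0 = 0 ->
    (forall (a : R) z, p (a%:C * z) = a * p z) ->
    p (lincomb sigma F (fun g => (f t g)%:C * c g) xi h) @[t --> FF] -->
    p (lincomb sigma F (fun g => (l g)%:C * c g) xi h).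
  move=> pD p0 pZ.
  have E (q : G -> R) : p (lincomb sigma F (fun g => (q g)%:C * c g) xi h) =
      \sum_(g <- F) q g * p (c g * Lam sigma g xi h).
    by rewrite /lincomb (big_morph p pD p0); apply: eq_bigr => g _; rewrite -mulrA pZ.
  rewrite E; under eq_cvg do rewrite E.
  by apply: cvg_sum_seq => g; apply: cvgMr_tmp; exact: fl.
apply: cvgD; rewrite !expr2; apply: cvgM.
- by apply: proj => [[? ?] [? ?]||? [? ?]] //=; rewrite mul0r subr0.
- by apply: proj => [[? ?] [? ?]||? [? ?]] //=; rewrite mul0r subr0.
- by apply: proj => [[? ?] [? ?]||? [? ?]] //=; rewrite mul0r addr0.
- by apply: proj => [[? ?] [? ?]||? [? ?]] //=; rewrite mul0r addr0.
Qed.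

End Multipliers.

(** * Gaussians as contractive multipliers *)

Section PositiveDefinite.
Variables (R : realType) (N : nat).
Local Notation C := (R[i]).
Local Notation G := ('rV[int]_N).
Variable sigma : G -> G -> C.
Implicit Types (f psi : G -> R).
Local Notation rmult := (rmultiplier sigma).

Lemma rmultiplier_cst (a : R) : 0 <= a -> rmult (fun=> a) a.
Proof. exact: multiplier_const. Qed.

Lemma rmultiplierM1 f1 f2 : rmult f1 1 -> rmult f2 1 -> rmult (fun g => f1 g * f2 g) 1.
Proof. by move=> f11 f21; rewrite -(mulr1 1); exact: rmultiplierM. Qed.

Lemma rmultiplier_exprn f n : rmult f 1 -> rmult (fun g => f g ^+ n) 1.
Proof.
move=> f1; elim: n => [|n IH].
  by under eq_fun do rewrite expr0; exact: rmultiplier_cst.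
by under eq_fun do rewrite exprS; exact: rmultiplierM1.
Qed.

Lemma rmultiplier_prod (I : Type) (r : seq I) (f : I -> G -> R) :
  (forall i, rmult (f i) 1) -> rmult (fun g => \prod_(i <- r) f i g) 1.
Proof.
move=> f1; elim: r => [|i r IH].
  by under eq_fun do rewrite big_nil; exact: rmultiplier_cst.
by under eq_fun do rewrite big_cons; exact: rmultiplierM1.
Qed.

Lemma rmultiplier_sum (I : Type) (r : seq I) (f : I -> G -> R) (m : I -> R) :
  (forall i, 0 <= m i) -> (forall i, rmult (f i) (m i)) ->
  rmult (fun g => \sum_(i <- r) f i g) (\sum_(i <- r) m i).
Proof.
move=> m0 fm; elim: r => [|i r IH].
  by rewrite big_nil; under eq_fun do rewrite big_nil; exact: rmultiplier_cst.
rewrite big_cons; under eq_fun do rewrite big_cons.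
by apply: rmultiplierD => //; exact: sumr_ge0.
Qed.

(** The truncated series of exp(c f) is a polynomial in f with nonnegative coefficients, so its
    bound is the same truncation of exp(c); the factor exp(-c) brings this down to at most 1. *)
Lemma rmultiplier_expR_sub f c : 0 <= c -> rmult f 1 ->
  rmult (fun g => expR (- (c * (1 - f g)))) 1.
Proof.
move=> c0 f1; pose S x := series (exp_coeff (x : R)).
have SE x : S x n @[n --> \oo] --> expR x by exact: is_cvg_series_exp_coeff.
apply: (@rmultiplier_lim R N sigma nat \oo _
  (fun n g => expR (- c) * S (c * f g) n)) => [g|].
  have -> : - (c * (1 - f g)) = - c + c * f g by ring.
  by rewrite expRD; apply: cvgMl_tmp; exact: SE.
apply: nearW => n.
have Sle : S c n <= expR c.
  apply: nondecreasing_cvgn_le; last exact: is_cvg_series_exp_coeff.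
  by apply: nondecreasing_series => k _ _; exact: exp_coeff_ge0.
have S0 : 0 <= S c n by apply: sumr_ge0 => k _; exact: exp_coeff_ge0.
apply: (@rmultiplier_le _ _ _ _ (expR (- c) * S c n)).
- by rewrite mulr_ge0// expR_ge0.
- by rewrite expRN -(mulVf (lt0r_neq0 (expR_gt0 c))) ler_wpM2l// invr_ge0 expR_ge0.
apply: rmultiplierZ => //.
apply: rmultiplier_sum => [k|k]; first exact: exp_coeff_ge0.
have := rmultiplierZ (exp_coeff_ge0 k c0) ler01 (rmultiplier_exprn k f1).
rewrite mulr1; apply: multiplier_eq => g.
by rewrite /exp_coeff /= exprMn mulrAC.
Qed.

(** Used with sin for the Gaussians and with exp for the square roots. With a inside F, the case a =
    0 needs no separate treatment. *)
Lemma cvg_slope_at_right (F : R -> R) (a d : R) :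
  is_derive (0 : R) (1 : R) F d -> (F (a * h) - F 0) / h @[h --> 0^'+] --> a * d.
Proof.
move=> dF; have D : is_derive (0 : R) (1 : R) (F \o ( *%R a)) (d * a).
  apply: is_derive1_comp; first by rewrite mulr0.
  have := @is_deriveZ _ _ _ (@id R) a 0 1 1 (is_derive_id _ _).
  by rewrite /GRing.scale/= mulr1.
rewrite mulrC; apply: cvg_dnbhs_at_right.
have : h^-1 *: ((F \o ( *%R a)) (h *: 1 + 0) - (F \o ( *%R a)) 0) @[h --> (0 : R)^'] --> d * a.
  by rewrite -(@derive_val _ _ _ _ _ _ _ D); exact: (@ex_derive _ _ _ _ _ _ _ D).
apply: cvg_trans; apply: near_eq_cvg; near=> h.
by rewrite /= mulr0 addr0 /GRing.scale/= mulr1 mulrC.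
Unshelve. all: by end_near. Qed.

Lemma rmultiplier_cos (i : 'I_N) (th : R) :
  rmult (fun g => cos (th * (g ord0 i)%:~R)) 1.
Proof.
pose chi (th : R) (g : G) : C := (cos (th * (g ord0 i)%:~R)) +i* sin (th * (g ord0 i)%:~R).
have chim t : multiplier sigma (chi t) 1.
  apply: multiplier_char => [g h|g]; last by rewrite /cabs2 /= cos2Dsin2.
  rewrite /chi mxE rmorphD /= mulrDr cosD sinD.
  by apply/eqP; rewrite eq_complex /=; apply/andP; split; apply/eqP; ring.
have half0 : (0 : R) <= 2^-1 by rewrite invr_ge0.
(* The cosine is the mean of the characters with parameters th and -th. *)
have := multiplierM (addr_ge0 ler01 ler01) (multiplier_const half0)
  (multiplierD ler01 ler01 (chim th) (chim (- th))).
rewrite (_ : 2^-1 * (1 + 1) = 1); last by field.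
apply: multiplier_eq => g; rewrite /chi mulNr cosN sinN.
by apply/eqP; rewrite eq_complex /=; apply/andP; split; apply/eqP; field.
Qed.

Lemma rmultiplier_gauss (i : 'I_N) (t : R) : 0 <= t ->
  rmult (fun g => expR (- (t * ((g ord0 i)%:~R : R) ^+ 2))) 1.
Proof.
move=> t0; apply: (@rmultiplier_lim R N sigma _ ((0 : R)^'+) _
  (fun h g => expR (- (2 * t / h ^+ 2 * (1 - cos (h * (g ord0 i)%:~R)))))) => [g|].
  set x : R := (g ord0 i)%:~R.
  apply: continuous_cvg; first exact: continuous_expR.
  apply: cvgN.
  (* Since 1 - cos(h x) = 2 sin(h x / 2)^2, the exponent is 4 t (sin(h x / 2) / h)^2 up to sign,
     which tends to 4 t (x / 2)^2 = t x^2. *)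
  have := @cvg_slope_at_right _ (x / 2) _ (is_derive_sin 0).
  rewrite sin0 cos0 mulr1 => sl.
  have := cvgMr_tmp (b := 4 * t) (cvgM sl sl).
  rewrite (_ : x / 2 * (x / 2) * (4 * t) = t * x ^+ 2); last by field.
  move=> /(_ _ _); apply: cvg_trans; apply: near_eq_cvg; near=> h.
  rewrite /= (_ : h * x = (x / 2 * h) *+ 2); last by rewrite -mulr_natr; field.
  rewrite cos_mulr2n subr0 (_ : 1 - _ = 2 * sin (x / 2 * h) ^+ 2); last by rewrite sin2cos2; ring.
  by field; near: h; exact: nbhs_right_neq.
near=> h; apply: rmultiplier_expR_sub; last exact: rmultiplier_cos.
by rewrite divr_ge0 ?mulr_ge0 ?sqr_ge0.
Unshelve. all: by end_near. Qed.

End PositiveDefinite.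

(** * The iteration converging to 1 - sqrt(1 - u) *)

Section SquareRoot.
Variable R : realType.

(** The fixed points of the recursion are 1 - sqrt(1 - u) and 1 + sqrt(1 - u); the start at 0
    selects the smaller one. *)
Fixpoint sqrt_iter (u : R) (n : nat) : R :=
  if n is n'.+1 then (u + sqrt_iter u n' ^+ 2) / 2 else 0.

(** With limit w <= 1, iterate v and error e = w - v, the next error is e (w + v) / 2 <= e (2 - e) /
    2. The map e -> e (2 - e) / 2 increases on [0, 1] and sends 2/(n+2) below 2/(n+3). The rate is
    uniform in u, including u = 1. *)
Lemma sqrt_iter_error (u : R) n : 0 <= u -> u <= 1 ->
  0 <= 1 - Num.sqrt (1 - u) - sqrt_iter u n <= 2 / n.+2%:R.
Proof.
move=> u0 u1; set w := 1 - Num.sqrt (1 - u).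
have s0 : 0 <= Num.sqrt (1 - u) by exact: sqrtr_ge0.
have s2 : Num.sqrt (1 - u) ^+ 2 = 1 - u by rewrite sqr_sqrtr ?subr_ge0.
have w1 : w <= 1 by rewrite /w; lra.
have w0 : 0 <= w by rewrite /w; nra.
have wE : u = 2 * w - w ^+ 2.
  have -> : 2 * w - w ^+ 2 = 1 - Num.sqrt (1 - u) ^+ 2 by rewrite /w; ring.
  by rewrite s2; ring.
(* Nonnegativity of the iterate joins the induction because the sign of the next error needs w + v
   >= 0. *)
have : 0 <= sqrt_iter u n /\ 0 <= w - sqrt_iter u n <= 2 / n.+2%:R.
  elim: n => [|n [v0 /andP[v1 v2]]] /=.
    by rewrite subr0 w0 /= divff ?w1.
  set v := sqrt_iter u n in v0 v1 v2 *.
  split; first by rewrite divr_ge0// addr_ge0// sqr_ge0.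
  have -> : w - (u + v ^+ 2) / 2 = (w - v) * (w + v) / 2 by rewrite wE; field.
  apply/andP; split; first by rewrite !mulr_ge0// addr_ge0.
  set e := w - v in v1 v2 *.
  apply: (@le_trans _ _ (e * (2 - e) / 2)).
    by rewrite ler_pM2r// ler_wpM2l// /e; lra.
  have e1 : 2 / n.+2%:R <= 1 :> R by rewrite ler_pdivrMr// mul1r ler_nat.
  set d := 2 / n.+2%:R in v2 e1.
  apply: (@le_trans _ _ (d * (2 - d) / 2)).
    rewrite ler_pM2r// -subr_ge0.
    have -> : d * (2 - d) - e * (2 - e) = (d - e) * (2 - d - e) by ring.
    by rewrite mulr_ge0; lra.
  rewrite /d -[in n.+3%:R]natr1; set x : R := n.+2%:R.
  have x0 : 0 < x by rewrite /x ltr0n.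
  rewrite -subr_ge0.
  have -> : 2 / (x + 1) - 2 / x * (2 - 2 / x) / 2 = 2 / (x ^+ 2 * (x + 1)).
    by field; rewrite !lt0r_neq0//; lra.
  by rewrite divr_ge0// mulr_ge0 ?sqr_ge0//; lra.
by case.
Qed.

Lemma cvg_sqrt_iter (u : R) : 0 <= u -> u <= 1 ->
  sqrt_iter u n @[n --> \oo] --> 1 - Num.sqrt (1 - u).
Proof.
move=> u0 u1; set w := 1 - Num.sqrt (1 - u).
(* [harmonic n] is 1/(n+1), so the error bound 2/(n+2) is [2 * harmonic n.+1]. *)
have h : 2 * harmonic n.+1 @[n --> \oo] --> (0 : R).
  rewrite -[X in _ --> X](mulr0 2); apply: cvgMl_tmp.
  by have := @cvg_harmonic R; rewrite -cvg_shiftS.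
have : w - 2 * harmonic n.+1 @[n --> \oo] --> w - 0 by apply: cvgB => //; exact: cvg_cst.
rewrite subr0 => lo; apply: (squeeze_cvgr _ lo (cvg_cst w)).
apply: nearW => n; have /andP[] := sqrt_iter_error n u0 u1.
rewrite /harmonic /= -/w => ? ?; apply/andP; split; last by rewrite -subr_ge0.
by rewrite lerBlDl -lerBlDr.
Qed.

End SquareRoot.

(** * Passing from psi to its square root, and the three lengths *)

Section Subordination.
Variables (R : realType) (N : nat).
Local Notation C := (R[i]).
Local Notation G := ('rV[int]_N).
Variable sigma : G -> G -> C.
Implicit Types (f psi : G -> R).
Local Notation rmult := (rmultiplier sigma).

Lemma rmultiplier_sqrt f : (forall g, 0 <= f g <= 1) -> rmult f 1 ->
  rmult (fun g => 1 - Num.sqrt (1 - f g)) 1.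
Proof.
move=> f01 f1; apply: (@rmultiplier_lim R N sigma nat \oo _
  (fun n g => sqrt_iter (f g) n)) => [g|].
  by have /andP[] := f01 g; exact: cvg_sqrt_iter.
(* Each iterate is the mean of f and of the square of the previous iterate, so the bound 1
   propagates. *)
apply: nearW; elim=> [|n IH].
  exact: rmultiplier_le (lexx 0) ler01 (rmultiplier_cst (lexx 0)).
have half0 : (0 : R) <= 2^-1 by rewrite invr_ge0.
have := rmultiplierZ half0 (addr_ge0 ler01 ler01)
  (rmultiplierD ler01 ler01 f1 (rmultiplierM1 IH IH)).
rewrite (_ : 2^-1 * (1 + 1) = 1); last by field.
by apply: multiplier_eq => g /=; rewrite mulrC expr2.
Qed.

Lemma rmultiplier_expR_sqrt psi : (forall g, 0 <= psi g) ->
  (forall t, 0 <= t -> rmult (fun g => expR (- (t * psi g))) 1) ->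
  forall t, 0 <= t -> rmult (fun g => expR (- (t * Num.sqrt (psi g)))) 1.
Proof.
move=> psi0 psi1 t t0; apply: (@rmultiplier_lim R N sigma _ ((0 : R)^'+) _
  (fun h g => expR (- (t / Num.sqrt h * Num.sqrt (1 - expR (- (h * psi g))))))) => [g|].
  apply: continuous_cvg; first exact: continuous_expR.
  apply: cvgN.
  (* (1 - exp(-h psi)) / h tends to psi; taking square roots turns the prefactor t / sqrt h into the
     limit t sqrt psi. *)
  have := @cvg_slope_at_right _ _ (- psi g) _ (is_derive_expR 0).
  rewrite expR0 mulr1 => /cvgN; rewrite opprK => sl.
  have sl2 := continuous_cvg (at_right_proper_filter 0) (@sqrt_continuous R (psi g)) sl.
  have /(_ _) := cvgMl_tmp (a := t) sl2.
  apply: cvg_trans; apply: near_eq_cvg; near=> h.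
  have h0 : 0 < h by near: h; exact: nbhs_right_gt.
  rewrite /= -mulNr opprB sqrtrM ?sqrtrV; last 2 first.
  - exact: ltW.
  - by rewrite subr_ge0 -[X in _ <= X]expR0 ler_expR mulNr oppr_le0 mulr_ge0// ltW.
  by rewrite (mulrC h) -mulNr mulrA mulrAC.
near=> h.
have h0 : 0 < h by near: h; exact: nbhs_right_gt.
have := @rmultiplier_sqrt (fun g => expR (- (h * psi g))) _ (psi1 _ (ltW h0)).
move=> /(_ _)/(rmultiplier_expR_sub (divr_ge0 t0 (sqrtr_ge0 h))) H.
apply: (multiplier_eq _ (H _)) => g.
  by rewrite subKr.
by rewrite expR_ge0 -[X in _ <= X]expR0 ler_expR oppr_le0 mulr_ge0// ltW.
Unshelve. all: by end_near. Qed.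

Lemma rmultiplier_expR_l2norm2 (t : R) : 0 <= t ->
  rmult (fun g => expR (- (t * @l2norm2 R N g))) 1.
Proof.
move=> t0; have := rmultiplier_prod (index_enum 'I_N)
  (fun i => @rmultiplier_gauss R N sigma i t t0).
by apply: multiplier_eq => g; rewrite -expR_sum /l2norm2 sumrN mulr_sumr.
Qed.

Lemma l2norm2_ge0 (g : G) : 0 <= @l2norm2 R N g.
Proof. by apply: sumr_ge0 => i _; exact: sqr_ge0. Qed.

Lemma rmultiplier_expR_l2norm (t : R) : 0 <= t ->
  rmult (fun g => expR (- (t * @l2norm R N g))) 1.
Proof.
by apply: rmultiplier_expR_sqrt => // [g|s]; [exact: l2norm2_ge0|exact: rmultiplier_expR_l2norm2].
Qed.

Lemma rmultiplier_expR_l1norm (t : R) : 0 <= t ->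
  rmult (fun g => expR (- (t * @l1norm R N g))) 1.
Proof.
move=> t0; have abs1 (i : 'I_N) := @rmultiplier_expR_sqrt
  (fun g => ((g ord0 i)%:~R : R) ^+ 2) (fun g => sqr_ge0 _)
  (@rmultiplier_gauss R N sigma i) t t0.
have := rmultiplier_prod (index_enum 'I_N) abs1.
apply: multiplier_eq => g; rewrite -expR_sum /l1norm sumrN mulr_sumr.
by under eq_bigr do rewrite sqrtr_sqr.
Qed.

End Subordination.

(** * Summability of exp(-t L) by comparison with the l^1-norm *)

Section Summability.
Variables (R : realType) (N : nat).
Local Notation G := ('rV[int]_N).
Implicit Types (F : seq G) (q t : R).

Lemma geometric_sum_le q n : 0 <= q -> q < 1 -> \sum_(k < n) q ^+ k <= (1 - q)^-1.
Proof.
move=> q0 q1; rewrite -[leRHS]mul1r ler_pdivlMr ?subr_gt0// mulrC.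
by rewrite -opprB mulNr -subrX1 opprB gerBl exprn_ge0.
Qed.

(** Each coordinate is coded by its sign and absolute value. Summing over all codes only enlarges
    the sum and makes it a product of N factors, each two geometric sums. *)
Lemma sum_prod_expr_le q F : 0 <= q -> q < 1 -> uniq F ->
  \sum_(g <- F) \prod_(i < N) q ^+ `|g ord0 i|%N <= (2 * (1 - q)^-1) ^+ N.
Proof.
(* A crude bound for all coordinates occurring in F, so that the codes range over a finite type. *)
move=> q0 q1 uF; set m := (\sum_(g <- F) \sum_(i < N) `|g ord0 i|)%N.
have ltm g i : g \in F -> (`|g ord0 i| < m.+1)%N.
  move=> gF; rewrite ltnS /m (big_rem g)//= (bigD1 i)//= -addnA; exact: leq_addr.
pose e (g : G) := [ffun i : 'I_N => (g ord0 i < 0, inord `|g ord0 i| : 'I_m.+1)].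
have e_inj : {in F &, injective e}.
  move=> g h gF hF /ffunP gh; apply/rowP => i.
  have := gh i; rewrite !ffunE => -[sgn /(congr1 val)]; rewrite /= !inordK ?ltm// => abs.
  rewrite [LHS]intEsign [RHS]intEsign abs; congr ((-1) ^+ _ * _).
  by rewrite sgn.
pose w (f : {ffun 'I_N -> bool * 'I_m.+1}) := \prod_(i < N) q ^+ (f i).2.
have w0 f : 0 <= w f by apply: prodr_ge0 => i _; exact: exprn_ge0.
have -> : \sum_(g <- F) \prod_(i < N) q ^+ `|g ord0 i|%N = \sum_(f <- map e F) w f.
  rewrite big_map [LHS]big_seq [RHS]big_seq; apply: eq_bigr => g gF.
  by apply: eq_bigr => i _; rewrite ffunE /= inordK ?ltm.
apply: (@le_trans _ _ (\sum_f w f)).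
  rewrite big_uniq ?map_inj_in_uniq//= big_mkcond/=.
  by apply: ler_sum => f _; case: ifP.
rewrite /w -(bigA_distr_bigA (fun (_ : 'I_N) (j : bool * 'I_m.+1) => q ^+ j.2))/=.
rewrite prodr_const card_ord; apply: lerXn2r; rewrite ?nnegrE.
- by apply: sumr_ge0 => j _; exact: exprn_ge0.
- by rewrite mulr_ge0// invr_ge0 subr_ge0 ltW.
rewrite -(pair_bigA _ (fun (b : bool) (k : 'I_m.+1) => q ^+ k))/= big_const card_bool /=.
by rewrite addr0 -mulr2n -[leLHS]mulr_natl ler_pM2l// geometric_sum_le.
Qed.

Lemma sum_expR_bounded (L : G -> R) (k t : R) : 0 < k ->
  (forall g, @l1norm R N g <= k * L g) -> 0 < t ->
  exists2 B, 0 <= B & forall F, uniq F -> \sum_(g <- F) expR (- (t * L g)) <= B.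
Proof.
move=> k0 kL t0; set q := expR (- (t / k)).
have q0 : 0 <= q by exact: expR_ge0.
have q1 : q < 1 by rewrite /q -expR0 ltr_expR oppr_lt0 divr_gt0.
exists ((2 * (1 - q)^-1) ^+ N) => [|F uF].
  by rewrite exprn_ge0// mulr_ge0// invr_ge0 subr_ge0 ltW.
apply: le_trans (sum_prod_expr_le q0 q1 uF); apply: ler_sum => g _.
(* The ratio q = exp(-t/k) is chosen so that the product is exp(-(t/k)|g|_1), which dominates exp(-t
   L(g)). *)
have -> : \prod_(i < N) q ^+ `|g ord0 i|%N = expR (- (t / k * @l1norm R N g)).
  rewrite /l1norm mulr_sumr -sumrN expR_sum; apply: eq_bigr => i _.
  by rewrite /q -expRM_natl -intr_norm -abszE mulrN mulrC.
by rewrite ler_expR lerN2 -mulrA ler_wpM2l ?(ltW t0)// ler_pdivrMl.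
Qed.

Lemma l1norm_le_l2norm2 (g : G) : @l1norm R N g <= @l2norm2 R N g.
Proof.
apply: ler_sum => i _; rewrite -intr_norm -rmorphXn/= ler_int.
by rewrite -real_normK ?num_real//; case: (`|_|) (normr_ge0 (g ord0 i)) => // -[|n] _; rewrite expr2; lia.
Qed.

(** Bounding each coordinate by the l^2-norm gives the factor N; N + 1 keeps the constant positive
    when N = 0. *)
Lemma l1norm_le_l2norm (g : G) : @l1norm R N g <= N.+1%:R * @l2norm R N g.
Proof.
have -> : N.+1%:R * @l2norm R N g = \sum_(i < N) @l2norm R N g + @l2norm R N g.
  by rewrite sumr_const card_ord -[_ *+ N]mulr_natl -natr1 mulrDl mul1r.
apply: ler_wpDr; first exact: sqrtr_ge0.
apply: ler_sum => i _; rewrite -sqrtr_sqr ler_wsqrtr// /l2norm2 (bigD1 i)//= lerDl.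
by apply: sumr_ge0 => j _; exact: sqr_ge0.
Qed.

End Summability.

(** * Unconditional sums as limits over finite subsets *)

Section UnconditionalSums.
Variables (R : realType) (I : eqType).
Local Notation normc := (@ComplexField.Normc.normc R).
Implicit Types (F : seq I).

Definition sums_to (y : I -> R) (z : R) : Prop := forall e : R, 0 < e ->
  exists F0 : seq I, forall F, uniq F -> {subset F0 <= F} ->
  `|z - \sum_(i <- F) y i| <= e.

Lemma sum_split_subseq (V : zmodType) (y : I -> V) F F' : uniq F -> uniq F' ->
  {subset F <= F'} ->
  \sum_(i <- F') y i = \sum_(i <- F) y i + \sum_(i <- F' | i \notin F) y i.
Proof.
move=> uF uF' FF'; rewrite (bigID (mem F))/=; congr (_ + _).
rewrite -big_filter; apply: perm_big; apply: uniq_perm => //.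
  exact: filter_uniq.
by move=> i; rewrite mem_filter; case: (boolP (i \in F)) => //= /FF' ->.
Qed.

Lemma big_uniq_pred1 (V : zmodType) (y : I -> V) F k : uniq F ->
  \sum_(i <- F | i == k) y i = if k \in F then y k else 0.
Proof.
elim: F => [|i F IH] /=; first by rewrite big_nil.
move=> /andP[iF uF]; rewrite big_cons IH// inE eq_sym.
by have [->|_] //= := eqVneq k i; rewrite (negbTE iF) addr0.
Qed.

(** The sum is the supremum of the finite partial sums. *)
Lemma ge0_sums_to (w : I -> R) (B : R) : (forall i, 0 <= w i) ->
  (forall F, uniq F -> \sum_(i <- F) w i <= B) -> exists z, sums_to w z.
Proof.
move=> w0 wB; pose A := [set \sum_(i <- F) w i | F in [set F | uniq F]].
have A0 : A 0 by exists [::] => //; rewrite big_nil.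
have hA : has_sup A.
  by split; [exists 0|exists B => _ [F uF <-]; exact: wB].
exists (sup A) => e e0.
have [_ [F0 uF0 <-] F0e] := sup_adherent e0 hA.
exists F0 => F uF F0F; rewrite ger0_norm.
  rewrite lerBlDr -lerBlDl; apply: le_trans (ltW F0e) _.
  by rewrite (sum_split_subseq _ uF0 uF F0F) lerDl sumr_ge0.
by rewrite subr_ge0; apply: ub_le_sup; [case: hA|exists F].
Qed.

Lemma sums_toB (y y' : I -> R) (z z' : R) : sums_to y z -> sums_to y' z' ->
  sums_to (fun i => y i - y' i) (z - z').
Proof.
move=> yz yz' e e0; have e2 : 0 < e / 2 by rewrite divr_gt0.
have [F1 h1] := yz _ e2; have [F2 h2] := yz' _ e2.
exists (F1 ++ F2) => F uF sF; rewrite sumrB.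
have -> : z - z' - (\sum_(i <- F) y i - \sum_(i <- F) y' i) =
  (z - \sum_(i <- F) y i) - (z' - \sum_(i <- F) y' i) by ring.
rewrite (splitr e); apply: le_trans (ler_normB _ _) _; apply: lerD.
  by apply: h1 => // i iF; apply: sF; rewrite mem_cat iF.
by apply: h2 => // i iF; apply: sF; rewrite mem_cat iF orbT.
Qed.

(** Write y = (y + w) - w, a difference of two nonnegative families with bounded partial sums. *)
Lemma abs_sums_to (y w : I -> R) (B : R) : (forall i, `|y i| <= w i) ->
  (forall F, uniq F -> \sum_(i <- F) w i <= B) -> exists z, sums_to y z.
Proof.
move=> yw wB; have w0 i : 0 <= w i by apply: le_trans (yw i).
have [z1 h1] := ge0_sums_to w0 wB.
have [|F uF|z2 h2] := @ge0_sums_to (fun i => y i + w i) (B + B).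
- by move=> i; have := yw i; rewrite ler_norml; lra.
- rewrite big_split/=; apply: lerD; last exact: wB.
  apply: le_trans (wB _ uF); apply: ler_sum => i _; exact: le_trans (ler_norm _) (yw i).
exists (z2 - z1); have := sums_toB h2 h1; congr (sums_to _ _).
by apply/funext => i; rewrite addrK.
Qed.

(** Cauchy criterion: the partial sums over F0 and over F0 together with F both lie within e/2 of
    the total. *)
Lemma sum_tail_le (w : I -> R) (B : R) : (forall i, 0 <= w i) ->
  (forall F, uniq F -> \sum_(i <- F) w i <= B) -> forall e, 0 < e ->
  exists F0 : seq I, forall F, uniq F -> (forall i, i \in F -> i \notin F0) ->
  \sum_(i <- F) w i <= e.
Proof.
move=> w0 wB e e0; have [z wz] := ge0_sums_to w0 wB.
have e2 : 0 < e / 2 by rewrite divr_gt0.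
have [F0 h] := wz _ e2; exists F0 => F uF FF0.
have uF0 : uniq (undup F0) by exact: undup_uniq.
have : `|z - \sum_(i <- undup F0) w i| <= e / 2.
  by apply: h => // i; rewrite mem_undup.
rewrite ler_norml => /andP[_ le0].
have : `|z - \sum_(i <- undup F0 ++ F) w i| <= e / 2.
  apply: h => [|i iF0]; last by rewrite mem_cat mem_undup iF0.
  rewrite cat_uniq uF0 uF andbT /=; apply/hasPn => i /FF0.
  by rewrite /= mem_undup.
rewrite big_cat/= ler_norml => /andP[]; lra.
Qed.

Lemma normc_le_add (z : R[i]) : normc z <= `|complex.Re z| + `|complex.Im z|.
Proof.
apply: normc_le; first exact: addr_ge0.
case: z => a b; rewrite /cabs2 /= sqrrD !real_normK ?num_real// lerD2r lerDl.
by rewrite mulrn_wge0// mulr_ge0.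
Qed.

Lemma Re_le_normc (z : R[i]) : `|complex.Re z| <= normc z.
Proof.
by case: z => a b /=; rewrite -sqrtr_sqr ler_wsqrtr// lerDl sqr_ge0.
Qed.

Lemma Im_le_normc (z : R[i]) : `|complex.Im z| <= normc z.
Proof.
by case: z => a b /=; rewrite -sqrtr_sqr ler_wsqrtr// lerDr sqr_ge0.
Qed.

Lemma complex_abs_sums_to (a : I -> R[i]) (B : R) :
  (forall F, uniq F -> \sum_(i <- F) normc (a i) <= B) ->
  exists z : R[i], forall e : R, 0 < e ->
  exists F0 : seq I, forall F, uniq F -> {subset F0 <= F} ->
  normc (z - \sum_(i <- F) a i) <= e.
Proof.
move=> aB.
have [u hu] := abs_sums_to (fun i => Re_le_normc (a i)) aB.
have [v hv] := abs_sums_to (fun i => Im_le_normc (a i)) aB.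
exists (u +i* v) => e e0; have e2 : 0 < e / 2 by rewrite divr_gt0.
have [F1 h1] := hu _ e2; have [F2 h2] := hv _ e2.
exists (F1 ++ F2) => F uF sF; apply: le_trans (normc_le_add _) _.
have ReD : {morph @complex.Re R : z w / z + w} by move=> [? ?] [? ?].
have ImD : {morph @complex.Im R : z w / z + w} by move=> [? ?] [? ?].
have -> : complex.Re (u +i* v - \sum_(i <- F) a i) = u - \sum_(i <- F) complex.Re (a i).
  by rewrite -(big_morph _ ReD (erefl : complex.Re 0 = 0)); case: (\sum_(i <- F) _).
have -> : complex.Im (u +i* v - \sum_(i <- F) a i) = v - \sum_(i <- F) complex.Im (a i).
  by rewrite -(big_morph _ ImD (erefl : complex.Im 0 = 0)); case: (\sum_(i <- F) _).
rewrite (splitr e); apply: lerD.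
  by apply: h1 => // i iF; apply: sF; rewrite mem_cat iF.
by apply: h2 => // i iF; apply: sF; rewrite mem_cat iF orbT.
Qed.

End UnconditionalSums.

(** * Twisted Fourier series and Fourier coefficients *)

Section FourierSeries.
Variables (R : realType) (N : nat).
Local Notation C := (R[i]).
Local Notation G := ('rV[int]_N).
Local Notation normc := (@ComplexField.Normc.normc R).
Variable sigma : G -> G -> C.
Hypothesis sigma1 : forall g h, cabs2 (sigma g h) = 1.
Hypothesis sigma0 : forall g, sigma g 0 = 1.
Implicit Types (xi : G -> C) (F H : seq G) (b c : G -> C) (x S T : op R N).

Lemma lincomb_split F F' b xi h : uniq F -> uniq F' -> {subset F <= F'} ->
  lincomb sigma F' b xi h =
  lincomb sigma F b xi h + lincomb sigma [seq g <- F' | g \notin F] b xi h.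
Proof. by move=> uF uF' sF; rewrite /lincomb (sum_split_subseq _ uF uF' sF) big_filter. Qed.

Lemma lincombB F b c xi h : lincomb sigma F (fun g => b g - c g) xi h =
  lincomb sigma F b xi h - lincomb sigma F c xi h.
Proof. by rewrite /lincomb -sumrB; apply: eq_bigr => g _; rewrite mulrBl. Qed.

Lemma normc_Lam_le g xi h : unit_ball xi -> normc (Lam sigma g xi h) <= 1.
Proof. by apply: opbd_pt => //; exact: opbd_Lam. Qed.

(* Fatou: a bound on the tails, tested on finite subsets of G, passes to the pointwise limit. *)
Lemma lincomb_cvg b (B : R) :
  (forall F, uniq F -> \sum_(g <- F) normc (b g) <= B) ->
  exists S, forall e : R, 0 < e -> exists F0, forall F, uniq F -> {subset F0 <= F} ->
  opbd (opsub S (lincomb sigma F b)) e.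
Proof.
move=> bB.
(* Choice needs a value at every pair; outside the unit ball, where [opbd] never looks, it is 0. *)
have pt (p : (G -> C) * G) : exists z : C, unit_ball p.1 -> forall e : R, 0 < e ->
    exists F0, forall F, uniq F -> {subset F0 <= F} ->
    normc (z - lincomb sigma F b p.1 p.2) <= e.
  case: p => xi h /=; have [xi1|nxi] := pselect (unit_ball xi); last by exists 0.
  have aB F : uniq F -> \sum_(g <- F) normc (b g * Lam sigma g xi h) <= B.
    move=> uF; apply: le_trans (bB _ uF); apply: ler_sum => g _.
    by rewrite ComplexField.Normc.normcM -[leRHS]mulr1 ler_wpM2l ?normc_ge0//; exact: normc_Lam_le.
  by have [z hz] := complex_abs_sums_to aB; exists z => _; exact: hz.
have [S0 hS0] := choice pt; pose S : op R N := fun xi h => S0 (xi, h).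
have hS xi h : unit_ball xi -> forall e : R, 0 < e ->
    exists F0, forall F, uniq F -> {subset F0 <= F} ->
    normc (S xi h - lincomb sigma F b xi h) <= e by exact: (hS0 (xi, h)).
exists S => e e0; have e2 : 0 < e / 2 by rewrite divr_gt0.
have [F0 tailF0] := sum_tail_le (fun g => normc_ge0 (b g)) bB e2.
exists F0 => F uF F0F xi xi1 H uH.
(* Chosen so that size H terms, each at most d^2, add up to at most (e/2)^2; the successor avoids
   division by 0. *)
pose d := e / 2 / (size H).+1%:R.
have d0 : 0 < d by rewrite divr_gt0// ltr0Sn.
have [F1 hF1] : exists F1, forall F', uniq F' -> {subset F1 <= F'} ->
    {in H, forall h, normc (S xi h - lincomb sigma F' b xi h) <= d}.
  elim: (H) => [|h K [F1 IH]]; first by exists [::].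
  have [F2 h2] := hS xi h xi1 d d0.
  exists (F1 ++ F2) => F' uF' sF' k; rewrite inE => /orP[/eqP ->|kK].
    by apply: h2 => // g gF; apply: sF'; rewrite mem_cat gF orbT.
  by apply: IH => // g gF; apply: sF'; rewrite mem_cat gF.
(* The polynomial over F2 is close to S on H since F2 contains F1, and differs from the one over F
   by a tail since F2 contains F. *)
pose F2 := undup (F1 ++ F).
have uF2 : uniq F2 by exact: undup_uniq.
have sF1 : {subset F1 <= F2} by move=> g gF; rewrite mem_undup mem_cat gF.
have sF : {subset F <= F2} by move=> g gF; rewrite mem_undup mem_cat gF orbT.
rewrite (splitr e).
under eq_bigr => h _.
  rewrite /opsub (_ : _ - _ = (S xi h - lincomb sigma F2 b xi h) +
    lincomb sigma [seq g <- F2 | g \notin F] b xi h); last first.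
    by rewrite (lincomb_split b xi h uF uF2 sF); ring.
  over.
apply: minkowski_cabs2; [exact: ltW|exact: ltW| |].
  apply: (@le_trans _ _ (\sum_(h <- H) d ^+ 2)).
    rewrite [leLHS]big_seq [leRHS]big_seq; apply: ler_sum => h hH.
    by rewrite -normc_sqr ler_pXn2r ?nnegrE ?normc_ge0 ?(ltW d0)//; exact: (hF1 _ uF2 sF1).
  rewrite big_const_seq count_predT iter_addr_0.
  have -> : e / 2 = d * (size H).+1%:R by rewrite /d divfK// pnatr_eq0.
  by rewrite [leRHS]exprMn -[_ *+ size H]mulr_natr ler_wpM2l ?sqr_ge0// -natrX ler_nat; nia.
have tail : \sum_(g <- [seq g <- F2 | g \notin F]) normc (b g) <= e / 2.
  apply: tailF0; first exact: filter_uniq.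
  by move=> g; rewrite mem_filter => /andP[gF _]; apply: contra gF; exact: F0F.
apply: (opbd_le _ tail (opbd_lincomb sigma1 _ b)) => //.
by apply: sumr_ge0 => g _; exact: normc_ge0.
Qed.

Lemma unit_ball_delta_e : unit_ball (@delta_e R N).
Proof.
move=> H uH; rewrite (bigID (pred1 0))/= [X in _ + X]big1 ?addr0; last first.
  by move=> h /negbTE h0; rewrite /delta_e h0 cabs2_0.
rewrite big_uniq_pred1// /delta_e eqxx.
by case: ifP => // _; rewrite /cabs2 /= expr0n expr1n addr0.
Qed.

(** Normalization of the cocycle makes Lambda_sigma(k) send delta_e to delta_k. The list F may
    repeat, so coefficients at equal indices add up. *)
Lemma xhat_lincomb F c g :
  xhat (lincomb sigma F c) g = \sum_(k <- F | g == k) c k.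
Proof.
rewrite /xhat /lincomb [RHS]big_mkcond; apply: eq_bigr => k _.
rewrite /Lam /delta_e subr_eq0; case: eqP => [->|_]; last by rewrite !mulr0.
by rewrite subrr sigma0 !mulr1.
Qed.

(** Grouping the terms of F by index gives its Fourier coefficients; the other indices in F' have
    coefficient 0. *)
Lemma lincomb_xhat F F' (phi c : G -> C) xi h : uniq F' -> {subset F <= F'} ->
  lincomb sigma F' (fun g => phi g * xhat (lincomb sigma F c) g) xi h =
  lincomb sigma F (fun g => phi g * c g) xi h.
Proof.
move=> uF' sF; rewrite /lincomb.
under eq_bigr do rewrite xhat_lincomb mulr_sumr mulr_suml.
rewrite (exchange_big_dep xpredT)//= [LHS]big_seq [RHS]big_seq.
apply: eq_bigr => k kF; by rewrite big_uniq_pred1// sF.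
Qed.

Lemma xhat_close x y (e : R) g : 0 <= e -> opbd (opsub x y) e ->
  normc (xhat x g - xhat y g) <= e.
Proof. by move=> e0 xy; apply: (opbd_pt g e0 xy); exact: unit_ball_delta_e. Qed.

Lemma in_Cred_approx x (e : R) : in_Cred sigma x -> 0 < e ->
  exists F c, opbd (opsub x (lincomb sigma F c)) e.
Proof. by move=> xC /xC [F [c /opnorm_lt_opbd[_ ?]]]; exists F, c. Qed.

Lemma xhat_bounded x : in_Cred sigma x ->
  exists2 K : R, 0 <= K & forall g, normc (xhat x g) <= K.
Proof.
move=> /in_Cred_approx /(_ ltr01) [F [c bd]].
have s0 : 0 <= \sum_(g <- F) normc (c g) by apply: sumr_ge0 => g _; exact: normc_ge0.
exists (1 + \sum_(g <- F) normc (c g)); first by rewrite addr_ge0.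
move=> g; rewrite -[xhat x g](subrK (xhat (lincomb sigma F c) g)).
apply: le_trans (le_normcD _ _) _; apply: lerD.
  exact: xhat_close.
by apply: (opbd_pt g s0 (opbd_lincomb sigma1 F c)); exact: unit_ball_delta_e.
Qed.

End FourierSeries.

(** * The net r^L for a length L satisfying the common hypotheses *)

Section LengthFunction.
Variables (R : realType) (N : nat).
Local Notation C := (R[i]).
Local Notation G := ('rV[int]_N).
Local Notation normc := (@ComplexField.Normc.normc R).
Variable sigma : G -> G -> C.
Hypothesis sigma1 : forall g h, cabs2 (sigma g h) = 1.
Hypothesis sigma0 : forall g, sigma g 0 = 1.
Variables (L : G -> R) (k : R).
Hypothesis L0 : forall g, 0 <= L g.
Hypothesis k0 : 0 < k.
Hypothesis kL : forall g, @l1norm R N g <= k * L g.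
Hypothesis multL : forall t, 0 <= t -> rmultiplier sigma (fun g => expR (- (t * L g))) 1.
Implicit Types (r : R) (F : seq G) (c : G -> C) (x S : op R N).

Lemma powR_expR r g : 0 < r -> r `^ L g = expR (- (- ln r * L g)).
Proof. by move=> r0; rewrite /powR gt_eqF// mulNr opprK mulrC. Qed.

Lemma rmultiplier_powR r : 0 < r -> r < 1 -> rmultiplier sigma (fun g => r `^ L g) 1.
Proof.
move=> r0 r1; have t0 : 0 <= - ln r by rewrite oppr_ge0 ln_le0// ltW.
by apply: multiplier_eq (multL t0) => g; rewrite powR_expR.
Qed.

Lemma sum_powR_bounded r : 0 < r -> r < 1 ->
  exists2 B, 0 <= B & forall F, uniq F -> \sum_(g <- F) r `^ L g <= B.
Proof.
move=> r0 r1; have t0 : 0 < - ln r by rewrite oppr_gt0 ln_lt0// r0.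
have [B B0 hB] := sum_expR_bounded k0 kL t0.
exists B => // F uF; apply: le_trans (hB _ uF).
by under eq_bigr do rewrite powR_expR//.
Qed.

Lemma powR_ge1B r g : 2^-1 < r -> r < 1 -> 1 - r `^ L g <= 2 * L g * (1 - r).
Proof.
move=> r2 r1; have r0 : 0 < r by lra.
rewrite powR_expR//; set t := - ln r.
(* From 1 + t <= exp t = 1/r comes t r <= 1 - r, and r > 1/2 gives the factor 2. *)
have t1 : t <= 2 * (1 - r).
  have := expR_ge1Dx t; rewrite /t expRN lnK ?posrE// => h.
  have : (1 + - ln r) * r <= 1 by rewrite -ler_pdivlMr// div1r.
  have := ln_le0 (ltW r1); nra.
have := expR_ge1Dx (- (t * L g)).
have : t * L g <= 2 * (1 - r) * L g by exact: ler_wpM2r.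
lra.
Qed.

Lemma sum_powR_small F c (d : R) : 0 < d -> exists2 r0, r0 < 1 & forall r,
  r0 < r -> r < 1 -> 0 < r /\ \sum_(g <- F) normc (((r `^ L g)%:C - 1) * c g) <= d.
Proof.
move=> d0; pose K := \sum_(g <- F) 2 * L g * normc (c g).
have K0 : 0 <= K by apply: sumr_ge0 => g _; rewrite !mulr_ge0 ?normc_ge0.
(* The threshold 1/2 is what [powR_ge1B] requires; the other makes K (1 - r) <= d, with K + 1 to
   keep the denominator positive. *)
exists (Num.max 2^-1 (1 - d / (K + 1))).
  by rewrite gt_max; apply/andP; split; [lra|rewrite gtrBl divr_gt0// ltr_wpDl].
move=> r; rewrite gt_max => /andP[r2 rd] r1; split; first lra.
apply: (@le_trans _ _ (K * (1 - r))).
  rewrite /K mulr_suml; apply: ler_sum => g _.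
  rewrite ComplexField.Normc.normcM mulrAC ler_wpM2r ?normc_ge0// -normcN.
  have -> : - ((r `^ L g)%:C - 1) = (1 - r `^ L g)%:C by rewrite opprB rmorphB.
  rewrite normcR ?powR_ge1B// subr_ge0 powR_expR ?expR_le1; last lra.
  by rewrite oppr_le0 mulr_ge0// oppr_ge0 ln_le0// ltW.
have : (1 - r) * (K + 1) <= d by rewrite -ler_pdivlMr ?ltr_wpDl//; lra.
nra.
Qed.

Lemma in_MCF_powR r : 0 < r -> r < 1 -> in_MCF sigma (fun g => (r `^ L g)%:C).
Proof.
move=> r0 r1 x /(xhat_bounded sigma1) [K K0 xK].
have [B B0 hB] := sum_powR_bounded r0 r1.
have [|S hS] := @lincomb_cvg R N sigma sigma1 (fun g => (r `^ L g)%:C * xhat x g) (B * K).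
  move=> F uF; apply: (@le_trans _ _ ((\sum_(g <- F) r `^ L g) * K)).
    rewrite mulr_suml; apply: ler_sum => g _.
    by rewrite ComplexField.Normc.normcM normcR ?powR_ge0// ler_wpM2l ?powR_ge0.
  by rewrite ler_wpM2r// hB.
exists S => e e0; have e2 : 0 < e / 2 by rewrite divr_gt0.
have [F0 h0] := hS _ e2; exists F0 => F uF sF.
by apply: opbd_opnorm_lt (h0 _ uF sF); lra.
Qed.

Lemma mult_bounded_by_powR r : 0 < r -> r < 1 ->
  mult_bounded_by sigma (fun g => (r `^ L g)%:C) 1.
Proof.
move=> r0 r1 F c /=; rewrite mul1e.
move: (opnorm_ge0 (lincomb sigma F c)) (@opnorm_le _ _ (lincomb sigma F c)).
case: (opnorm (lincomb sigma F c)) => [M||] // M0 bdM; last by rewrite leey.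
rewrite lee_fin in M0; apply/opnorm_le => //; rewrite -[M]mul1r.
by apply: rmultiplier_powR => //; apply/bdM.
Qed.

(** S - x telescopes through y1, ..., y4, at a cost of d + d + 2d + d + d. *)
Lemma opbd_chain x S (y1 y2 y3 y4 : op R N) (d : R) : 0 <= d ->
  opbd (opsub S y1) d -> opbd (opsub y1 y2) d -> opbd (opsub y2 y3) (2 * d) ->
  opbd (opsub y3 y4) d -> opbd (opsub x y4) d -> opbd (opsub S x) (6 * d).
Proof.
move=> d0 h1 h2 h3 h4 /(opbdZ (-1)).
have -> : normc (-1) = 1 by rewrite /= oppr0 expr0n addr0 sqrrN expr1n sqrtr1.
rewrite mul1r => h5.
have d2 : 0 <= 2 * d by rewrite mulr_ge0.
have h12 := opbdD d0 d0 h1 h2.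
have h13 := opbdD (addr_ge0 d0 d0) d2 h12 h3.
have h14 := opbdD (addr_ge0 (addr_ge0 d0 d0) d2) d0 h13 h4.
have := opbdD (addr_ge0 (addr_ge0 (addr_ge0 d0 d0) d2) d0) d0 h14 h5.
rewrite (_ : d + d + 2 * d + d + d = 6 * d); last by ring.
have -> // : opsub S x = (fun xi h => opsub S y1 xi h + opsub y1 y2 xi h +
  opsub y2 y3 xi h + opsub y3 y4 xi h + -1 * opsub x y4 xi h).
by apply/funext => xi; apply/funext => h'; rewrite /opsub; ring.
Qed.

Lemma summing_powR x : in_Cred sigma x ->
  summing_left1 sigma (fun r g => (r `^ L g)%:C) x.
Proof.
(* The chain costs 6 d, strictly less than e. *)
move=> xC e e0; pose d := e / 8; have d0 : 0 < d by rewrite divr_gt0.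
have [F [c xp]] := in_Cred_approx xC d0.
have [r0 r01 hr0] := sum_powR_small F c d0.
exists r0 => // r r0r r1 S hS; have [rgt0 small] := hr0 r r0r r1.
have [B B0 hB] := sum_powR_bounded rgt0 r1.
(* A second approximation of x, allowed to depend on r. The multiplier bound concerns polynomials
   only, so x is first replaced by p' coefficient by coefficient, at a cost of at most B d' <= d.
   The polynomial p must not depend on r, since it determines [r0]. *)
pose d' := d / (B + 1).
have d'0 : 0 < d' by rewrite divr_gt0// ltr_wpDl.
have d'd : d' <= d by rewrite ler_pdivrMr ?ltr_wpDl// ler_peMr ?(ltW d0)// lerDr.
have [F' [c' xp']] := in_Cred_approx xC d'0.
have [F0 hF0] := hS _ d0.
pose p := lincomb sigma F c; pose p' := lincomb sigma F' c'.
pose K := undup (F0 ++ F' ++ F).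
have uK : uniq K by exact: undup_uniq.
have sF0 : {subset F0 <= K} by move=> g gF; rewrite mem_undup mem_cat gF.
have sF' : {subset F' <= K} by move=> g gF; rewrite mem_undup !mem_cat gF orbT.
have sF : {subset F <= K} by move=> g gF; rewrite mem_undup !mem_cat gF !orbT.
pose phi g := (r `^ L g)%:C.
suff : opbd (opsub S x) (6 * d) by apply: opbd_opnorm_lt; rewrite /d; lra.
apply: (@opbd_chain _ _ (lincomb sigma K (fun g => phi g * xhat x g))
  (lincomb sigma K (fun g => phi g * xhat p' g))
  (lincomb sigma K (fun g => phi g * xhat p g)) p) => //.
- exact: ltW.
- by have [_] := opnorm_lt_opbd (hF0 _ uK sF0).
- have -> : opsub (lincomb sigma K (fun g => phi g * xhat x g))
      (lincomb sigma K (fun g => phi g * xhat p' g)) =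
      lincomb sigma K (fun g => phi g * (xhat x g - xhat p' g)).
    apply/funext => xi; apply/funext => h; rewrite /opsub -lincombB.
    by congr (lincomb _ _ _ _ _); apply/funext => g; rewrite mulrBr.
  apply: (opbd_le _ _ (opbd_lincomb sigma1 _ _)).
    by apply: sumr_ge0 => g _; exact: normc_ge0.
  apply: (@le_trans _ _ (B * d')); last first.
    by rewrite /d' mulrA ler_pdivrMr ?ltr_wpDl// mulrC ler_pM2l//; lra.
  apply: (@le_trans _ _ ((\sum_(g <- K) r `^ L g) * d')); last first.
    by rewrite ler_wpM2r ?(ltW d'0)// hB.
  rewrite mulr_suml; apply: ler_sum => g _.
  rewrite ComplexField.Normc.normcM normcR ?powR_ge0// ler_wpM2l ?powR_ge0//.
  by apply: (xhat_close _ _ xp'); exact: ltW.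
- have -> : opsub (lincomb sigma K (fun g => phi g * xhat p' g))
      (lincomb sigma K (fun g => phi g * xhat p g)) =
      lincomb sigma K (fun g => phi g * (xhat p' g - xhat p g)).
    apply/funext => xi; apply/funext => h; rewrite /opsub -lincombB.
    by congr (lincomb _ _ _ _ _); apply/funext => g; rewrite mulrBr.
  rewrite -[2 * d]mul1r; apply: rmultiplier_powR => //; first by rewrite mulr_ge0// ltW.
  (* The bound 1, uniform in r, is applied to p' - p = (x - p) - (x - p'), of norm at most 2 d. *)
  have -> : lincomb sigma K (fun g => xhat p' g - xhat p g) =
      opsub (opsub x p) (opsub x p').
    apply/funext => xi; apply/funext => h; rewrite lincombB.
    have E F1 c1 : {subset F1 <= K} ->
        lincomb sigma K (xhat (lincomb sigma F1 c1)) xi h = lincomb sigma F1 c1 xi h.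
      move=> sF1; have := lincomb_xhat sigma0 (fun=> 1) c1 xi h uK sF1.
      by under eq_fun do rewrite mul1r; under [X in _ = lincomb _ _ X _ _]eq_fun do rewrite mul1r.
    by rewrite !E// /opsub -/p -/p'; ring.
  rewrite mulr2n mulrDl mul1r.
  by apply: opbd_sub => //; [exact: ltW|exact: ltW|exact: opbd_le (ltW d'0) d'd xp'].
- have -> : opsub (lincomb sigma K (fun g => phi g * xhat p g)) p =
      lincomb sigma F (fun g => (phi g - 1) * c g).
    apply/funext => xi; apply/funext => h; rewrite /opsub lincomb_xhat// -lincombB.
    by congr (lincomb _ _ _ _ _); apply/funext => g; rewrite mulrBl mul1r.
  apply: (opbd_le _ small (opbd_lincomb sigma1 _ _)).
  by apply: sumr_ge0 => g _; exact: normc_ge0.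
Qed.

Lemma bounded_fourier_summing_powR :
  bounded_fourier_summing_net_left1 sigma (fun r g => (r `^ L g)%:C).
Proof.
split; [exact: in_MCF_powR|exists 1; exact: mult_bounded_by_powR|exact: summing_powR].
Qed.

End LengthFunction.

Theorem theorem5p7 (R : realType) (N : nat) (L : 'rV[int]_N -> R)
    (sigma : 'rV[int]_N -> 'rV[int]_N -> R[i]) :
  is_normalized_2cocycle sigma ->
  (L = @l1norm R N \/ L = @l2norm R N \/ L = @l2norm2 R N) ->
  bounded_fourier_summing_net_left1 sigma
    (fun (r : R) (g : 'rV[int]_N) => (r `^ L g)%:C).
Proof.
move=> [sigma1 _ /all_and2[sigma0 _]] [->|[->|->]].
- apply: (@bounded_fourier_summing_powR _ _ _ _ _ _ 1) => // [g|g|t].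
  + by apply: sumr_ge0 => i _; exact: normr_ge0.
  + by rewrite mul1r.
  + exact: rmultiplier_expR_l1norm.
- apply: (@bounded_fourier_summing_powR _ _ _ _ _ _ N.+1%:R) => // [g|g|t].
  + exact: sqrtr_ge0.
  + exact: l1norm_le_l2norm.
  + exact: rmultiplier_expR_l2norm.
- apply: (@bounded_fourier_summing_powR _ _ _ _ _ _ 1) => // [g|g|t].
  + exact: l2norm2_ge0.
  + by rewrite mul1r; exact: l1norm_le_l2norm2.
  + exact: rmultiplier_expR_l2norm2.
Qed.
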